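(* Let $\alpha=(\alpha_1,\dots,\alpha_\ell)$ be a strong composition. If $\alpha$ has no inversions, then $\mathrm{QKT}(\alpha)$ consists only of the basic tableau of content $\alpha$. If $\alpha$ has at least one inversion, let $i$ be the smallest index with $\alpha_i<\alpha_{i+1}$, let $\hat\alpha=(\alpha_1,\dots,\alpha_{i-1},\alpha_{i+1},\alpha_i,\alpha_{i+2},\dots,\alpha_\ell)$, and for each $\hat T\in\mathrm{QKT}(\hat\alpha)$ define the set $S(\hat T)$ as follows: let $T_0$ be obtained from $\hat T$ by changing, in every column $c\ge \alpha_i+1$, every entry $i$ into $i+1$ and every entry $i+1$ into $i$; put $T_0$ in $S(\hat T)$; then for each $k=\alpha_i+1,\dots,\alpha_{i+1}$, if the cell in row $i+1$ and column $k$ of $T_0$ is empty and the cell in row $i$ and column $k$ of $T_0$ contains $i+1$, let $T_k$ be obtained from $T_0$ by swapping the cells (with their contents, or emptiness) of row $i$ and row $i+1$ in each of the columns $\alpha_i+1,\dots,k$, and put $T_k$ in $S(\hat T)$. Then $$\mathrm{QKT}(\alpha)=\bigcup_{\hat T\in\mathrm{QKT}(\hat\alpha)}S(\hat T).$$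
   Context: A weak composition $a=(a_1,\dots,a_\ell)$ is a finite sequence of nonnegative integers; a strong composition is one whose parts are all positive. An inversion of a strong composition $\alpha$ is a pair $(i,j)$ with $i<j$ and $\alpha_i<\alpha_j$. A diagram is a finite set of cells $(r,c)$ with $r,c$ positive integers, the cell $(r,c)$ lying in row $r$ (counted from the bottom) and column $c$ (counted from the left). A Kohnert tableau of content $a$ is a diagram whose cells are filled with positive integers, with exactly $a_i$ cells containing $i$ for each $i$, such that: (i) for each $i$ there is exactly one $i$ in each of the columns $1,\dots,a_i$; (ii) every entry in row $r$ is at least $r$; (iii) for each $i$, the cells containing $i$ weakly descend from left to right; (iv) if $i<j$ appear in the same column with $i$ above $j$, then there is an $i$ in the column immediately to the right of the cell containing that $j$, in a row strictly above it. It is quasi-Yamanouchi if moreover (v) for each nonempty row $r$, either row $r$ contains an entry equal to $r$, or some cell of row $r+1$ lies weakly to the right of some cell of row $r$. $\mathrm{QKT}(a)$ denotes the set of quasi-Yamanouchi Kohnert tableaux of content $a$. The basic tableau of content $a$ has, for each $i$, the cells $(i,1),\dots,(i,a_i)$ filled with $i$ and no other cells. *)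

(* Defs.v *)
From mathcomp Require Import all_boot finmap.
From mathcomp Require Import boolp classical_sets.

Set Implicit Arguments.
Unset Strict Implicit.
Unset Printing Implicit Defensive.

Local Open Scope fset_scope.
Local Open Scope fmap_scope.
Local Open Scope nat_scope.
Local Open Scope classical_set_scope.

(* Rows, columns, entries and the indices of compositions all start at 1;
   [part a i] is a_i, read as 0 outside 1 <= i <= size a. *)
Definition weak_composition := seq nat.

Definition part (a : weak_composition) (i : nat) : nat :=
  if i is j.+1 then nth 0 a j else 0.

Definition strong (a : weak_composition) : bool := all (leq 1) a.

Definition inversion (a : weak_composition) (i j : nat) : Prop :=
  [/\ 1 <= i, i < j, j <= size a & part a i < part a j].

Definition ascent (a : weak_composition) (i : nat) : Prop :=
  [/\ 1 <= i, i < size a & part a i < part a i.+1].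

Definition first_ascent (a : weak_composition) (i : nat) : Prop :=
  ascent a i /\ forall j, ascent a j -> i <= j.

Definition swap_parts (a : weak_composition) (i : nat) : weak_composition :=
  take i.-1 a ++ [:: part a i.+1; part a i] ++ drop i.+1 a.

(* A filled diagram: a finite set of cells (row, column), each with an entry.
   [T.[? (r, c)]] is [None] when the cell (r, c) is empty. *)
Definition filling := {fmap (nat * nat) -> nat}.

Definition on_positive_cells (T : filling) : Prop :=
  forall r c v, T.[? (r, c)] = Some v -> [/\ 1 <= r, 1 <= c & 1 <= v].

Definition has_content (a : weak_composition) (T : filling) : Prop :=
  forall i, 1 <= i -> #|` [fset p in domf T | T.[? p] == Some i]| = part a i.

Definition Kohnert_i (a : weak_composition) (T : filling) : Prop :=
  forall i c, 1 <= i -> 1 <= c <= part a i ->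
    exists! r, T.[? (r, c)] = Some i.

Definition Kohnert_ii (T : filling) : Prop :=
  forall r c v, T.[? (r, c)] = Some v -> r <= v.

Definition Kohnert_iii (T : filling) : Prop :=
  forall i r c r' c', T.[? (r, c)] = Some i -> T.[? (r', c')] = Some i ->
    c < c' -> r' <= r.

Definition Kohnert_iv (T : filling) : Prop :=
  forall i j c ri rj, i < j ->
    T.[? (ri, c)] = Some i -> T.[? (rj, c)] = Some j -> rj < ri ->
    exists2 r, rj < r & T.[? (r, c.+1)] = Some i.

Definition quasi_Yamanouchi (T : filling) : Prop :=
  forall r, (exists c, (r, c) \in domf T) ->
    (exists c, T.[? (r, c)] = Some r) \/
    (exists c c', [/\ (r, c) \in domf T, (r.+1, c') \in domf T & c <= c']).

Definition Kohnert_tableau (a : weak_composition) (T : filling) : Prop :=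
  [/\ on_positive_cells T, has_content a T, Kohnert_i a T
    & [/\ Kohnert_ii T, Kohnert_iii T & Kohnert_iv T]].

Definition QKT (a : weak_composition) : set filling :=
  [set T | Kohnert_tableau a T /\ quasi_Yamanouchi T].

Definition basic_tableau (a : weak_composition) : filling :=
  [fmap p : [fset q in [seq (i, c) | i <- iota 1 (size a),
                                      c <- iota 1 (part a i)]] => (val p).1].

Definition transp (i v : nat) : nat :=
  if v == i then i.+1 else if v == i.+1 then i else v.

(* Exchange the entries i and i+1 in every column c >= m. *)
Definition swap_entries (i m : nat) (T : filling) : filling :=
  [fmap p : domf T =>
    if m <= (val p).2 then transp i (T p) else T p].

Definition move_cell (i m k : nat) (p : nat * nat) : nat * nat :=
  if m <= p.2 <= k then (transp i p.1, p.2) else p.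

(* Exchange rows i and i+1 in the columns m, ..., k. [move_cell i m k] is an
   involution, so it both relocates the cells and recovers their old position;
   the default 0 is never used. *)
Definition swap_rows (i m k : nat) (T : filling) : filling :=
  [fmap p : (move_cell i m k @` domf T)%fset =>
    odflt 0 T.[? move_cell i m k (val p)]].

(* S(That), relative to alpha and i. *)
Definition S_set (alpha : weak_composition) (i : nat) (That : filling) :
    set filling :=
  let m := (part alpha i).+1 in
  let T0 := swap_entries i m That in
  [set T | T = T0 \/
    exists k, [/\ m <= k <= part alpha i.+1,
                  T0.[? (i.+1, k)] = None,
                  T0.[? (i, k)] = Some i.+1
                & T = swap_rows i m k T0]].

Lemma transpK i : involutive (transp i).
Proof.
move=> v; rewrite /transp; have [->|ne] := eqVneq v i.
  by rewrite eqxx (gtn_eqF (ltnSn i)).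
have [->|ne'] := eqVneq v i.+1; first by rewrite eqxx.
by rewrite (negbTE ne) (negbTE ne').
Qed.

Lemma move_cellK i m k : involutive (move_cell i m k).
Proof.
case=> r c; rewrite /move_cell /=.
by have [h|/negbTE h] := boolP (m <= c <= k); rewrite /= h ?transpK.
Qed.

Lemma basic_tableauE a r c :
  (basic_tableau a).[? (r, c)] =
  if (1 <= r) && (1 <= c <= part a r) then Some r else None.
Proof.
have E : ((r, c) \in domf (basic_tableau a)) =
         (1 <= r) && (1 <= c <= part a r).
  rewrite /= in_fset /=; apply/allpairsPdep/idP => [[x [y []]]|].
    by rewrite !mem_iota !add1n !ltnS => /andP[x1 _] y1 [-> ->]; rewrite x1.
  case/and3P=> r1 c1 cr; exists r, c; rewrite !mem_iota r1 c1 !add1n !ltnS.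
  split=> //; case: r r1 cr => // r _ /= cr; rewrite ltnNge.
  by apply/negP => /(nth_default 0) e; rewrite e leqNgt c1 in cr.
rewrite -E; case: ifP => h; last by rewrite not_fnd // h.
by rewrite in_fnd ffunE.
Qed.

Lemma swap_entriesE i m T r c :
  (swap_entries i m T).[? (r, c)] =
  omap (fun v => if m <= c then transp i v else v) T.[? (r, c)].
Proof.
have [h|h] := boolP ((r, c) \in domf T); last by rewrite !not_fnd.
by rewrite !in_fnd ffunE /=; congr Some.
Qed.

Lemma swap_rowsE i m k T p :
  (swap_rows i m k T).[? p] = T.[? move_cell i m k p].
Proof.
have E : (p \in domf (swap_rows i m k T)) = (move_cell i m k p \in domf T).
  by rewrite /= -{1}(move_cellK i m k p) mem_imfset //; apply: inv_inj (move_cellK _ _ _).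
have [h|h] := boolP (p \in domf (swap_rows i m k T)); last first.
  by rewrite !not_fnd // -E.
have h' := h; rewrite E in h'.
by rewrite (in_fnd h) ffunE /= (in_fnd h').
Qed.

(* Main.v *)
(* If [i] is the first ascent of [alpha] and [m = alpha_i], then the entries
   1, ..., i+1 all occur in each column [c <= m]; as no entry lies above its own
   row, they fill the rows 1, ..., i+1 of that column in order. This holds for
   both [alpha] and its swap, so [swap_entries] only renames the longer of the
   two entries, the shorter one being absent beyond column [m], and the only
   freedom is the column [k] up to which i+1 stays in row i+1. Moving that
   initial stretch between the rows i and i+1 is an involution that preserves
   the Kohnert conditions. The quasi-Yamanouchi condition only matters in the
   rows above i+1, which are never touched. *)
Require Import Defs.
From mathcomp Require Import all_boot finmap.
From mathcomp Require Import boolp classical_sets.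
From mathcomp Require Import zify.

Local Open Scope nat_scope.
Local Open Scope classical_set_scope.

Set Implicit Arguments.
Unset Strict Implicit.

(** * Parts of compositions and the transposition of [i] and [i.+1] *)

Lemma part_default a v : size a < v -> part a v = 0.
Proof. by case: v => // v; rewrite ltnS /= => /(nth_default 0). Qed.

Lemma transp_l i : transp i i = i.+1.
Proof. by rewrite /transp eqxx. Qed.

Lemma transp_r i : transp i i.+1 = i.
Proof. by rewrite -[i.+1]transp_l transpK. Qed.

Lemma transp_out i v : v != i -> v != i.+1 -> transp i v = v.
Proof. by rewrite /transp => /negbTE-> /negbTE->. Qed.

Lemma transp_spec i r :
  (r = i /\ transp i r = i.+1) \/ (r = i.+1 /\ transp i r = i) \/
  (r <> i /\ r <> i.+1 /\ transp i r = r).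
Proof.
case: (eqVneq r i) => [->|ri]; first by left; rewrite transp_l.
case: (eqVneq r i.+1) => [->|ri1]; first by right; left; rewrite transp_r.
by right; right; rewrite transp_out //; split=> //; [apply/eqP|split=> //; apply/eqP].
Qed.

Lemma part_swap a i v : 1 <= i -> i < size a ->
  part (swap_parts a i) v = part a (transp i v).
Proof.
case: i => // i _ lt_i; rewrite /transp /swap_parts /=.
case: v => [|v] /=; first by [].
rewrite !eqSS nth_cat size_take (ltnW lt_i).
case: eqVneq => [->|v_i]; first by rewrite ltnn subnn.
case: eqVneq => [->|v_i1]; first by rewrite ltnNge leqnSn /= subSnn.
case: ltnP => h; first by rewrite nth_take.
have -> : v - i = (v - i.+2).+2 by lia.
by rewrite /= nth_drop; congr nth; lia.
Qed.

Lemma swap_entriesK i m : involutive (swap_entries i m).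
Proof.
move=> T; apply/fmapP => -[r c]; rewrite !swap_entriesE.
by case: T.[? _]%fmap => //= v; case: (m <= c); rewrite ?transpK.
Qed.

Lemma swap_rowsK i m k : involutive (swap_rows i m k).
Proof. by move=> T; apply/fmapP => p; rewrite !swap_rowsE move_cellK. Qed.

(** * Kohnert tableaux as row functions *)

(* [P v c] is the row of the entry [v] of column [c]; it is a junk value unless
   [1 <= c <= part a v]. *)
Definition represents (a : weak_composition) (P : nat -> nat -> nat)
    (T : filling) : Prop :=
  forall r c v,
    T.[? (r, c)]%fmap = Some v <-> 1 <= c <= part a v /\ P v c = r.

(** In order: positive rows with (ii), at most one entry per cell, (iii) between adjacent columns,
    and (iv), whose witness can only be the row [P u c.+1]. Condition (i) and the content are built
    into the use of a function. *)
Definition Kohnert_rows (a : weak_composition) (P : nat -> nat -> nat) : Prop :=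
  [/\ forall v c, 1 <= c <= part a v -> 1 <= P v c <= v,
      forall u v c, 1 <= c <= part a u -> 1 <= c <= part a v ->
        P u c = P v c -> u = v,
      forall v c, 1 <= c < part a v -> P v c.+1 <= P v c
    & forall u v c, u < v -> 1 <= c <= part a u -> 1 <= c <= part a v ->
        P v c < P u c -> c < part a u /\ P v c < P u c.+1].

Lemma represents_inj a P T T' :
  represents a P T -> represents a P T' -> T = T'.
Proof.
move=> RT RT'; apply/fmapP => -[r c].
case E: T.[? _]%fmap => [v|]; first by move/RT/RT': E.
case E': T'.[? _]%fmap => [v|//]; by move/RT'/RT: E'; rewrite E.
Qed.

Lemma eq_represents a P Q T :
  (forall v c, 1 <= c <= part a v -> P v c = Q v c) ->
  represents a P T -> represents a Q T.
Proof.
move=> eqPQ RT r c v; rewrite RT.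
by split=> -[h <-]; rewrite (eqPQ _ _ h).
Qed.

Lemma card_represented a P T i : represents a P T ->
  #|` [fset p in domf T | T.[? p]%fmap == Some i]%fset| = part a i.
Proof.
move=> RT.
have -> : [fset p in domf T | T.[? p]%fmap == Some i]%fset =
          [fset p in [seq (P i c, c) | c <- iota 1 (part a i)]]%fset.
  apply/fsetP => -[r c]; rewrite !inE /=; apply/andP/mapP => [[_ /eqP/RT[h <-]]|].
    by exists c => //; rewrite mem_iota add1n ltnS.
  case=> c'; rewrite mem_iota add1n ltnS => h [-> ->].
  have E : T.[? (P i c', c')]%fmap = Some i by apply/RT.
  by rewrite -fndSome E.
rewrite card_fseq undup_id ?size_map ?size_iota //.
by rewrite map_inj_uniq ?iota_uniq // => x y [].
Qed.

(** Condition (i) supplies the row function by choice, and counting the cells of each entry rules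
    out any further cell. *)
Lemma Kohnert_tableauP a T :
  Kohnert_tableau a T <-> exists2 P, represents a P T & Kohnert_rows a P.
Proof.
split=> [[pos cont K1 [K2 K3 K4]]|[P RT [Pb Pi Pd Px]]].
  have /choice[P HP] : forall vc : nat * nat, exists r,
      1 <= vc.2 <= part a vc.1 -> T.[? (r, vc.2)]%fmap = Some vc.1.
    case=> -[|v] c; first by exists 0 => /=; lia.
    have [h|h] := boolP (1 <= c <= part a v.+1).
      by have [r [hr _]] := K1 v.+1 c isT h; exists r.
    by exists 0 => h1; case/negP: h.
  pose Q v c := P (v, c).
  have HQ v c : 1 <= c <= part a v -> T.[? (Q v c, c)]%fmap = Some v.
    by move/(HP (v, c)).
  have RT : represents a Q T.
    move=> r c v; split=> [E|[h <-]]; last exact: HQ.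
    have [_ _ v1] := pos _ _ _ E.
    (* Both sides have [part a v] cells. *)
    have sub : ([fset p in [seq (Q v c, c) | c <- iota 1 (part a v)]] `<=`
                [fset p in domf T | T.[? p]%fmap == Some v])%fset.
      apply/fsubsetP => p; rewrite !inE /= => /mapP[d]; rewrite mem_iota add1n ltnS.
      by move=> /HQ E' ->; rewrite -fndSome E' eqxx.
    have eqc := fsubset_leqif_cards sub.
    have : (r, c) \in [fset p in domf T | T.[? p]%fmap == Some v]%fset.
      by rewrite !inE /= -fndSome E eqxx.
    have /eqP <- : ([fset p in [seq (Q v c, c) | c <- iota 1 (part a v)]] ==
                [fset p in domf T | T.[? p]%fmap == Some v])%fset.
      rewrite -(eqc.2) (cont v v1) card_fseq undup_id ?size_map ?size_iota //.
      by rewrite map_inj_uniq ?iota_uniq // => x y [].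
    rewrite inE /= => /mapP[d]; rewrite mem_iota add1n ltnS => h [-> ->].
    by [].
  exists Q => //; split.
  - move=> v c /HQ E; have [-> _ _] := pos _ _ _ E; exact: K2 E.
  - move=> u v c /HQ E /HQ E' e; move: E; rewrite e E'; by case.
  - move=> v c h; apply: (K3 v _ c _ c.+1) => //; apply: HQ; lia.
  - move=> u v c uv hu hv lt.
    have [r lr /RT[h e]] := K4 u v c _ _ uv (HQ _ _ hu) (HQ _ _ hv) lt.
    by rewrite e; split=> //; lia.
split.
- move=> r c v /RT[h <-]; have := Pb _ _ h; split; lia.
- by move=> i _; apply: card_represented RT.
- move=> i c _ h; exists (P i c); split=> [|r /RT[]//].
  by apply/RT.
split.
- by move=> r c v /RT[h <-]; case/andP: (Pb _ _ h).
- move=> i r c r' c' /RT[h <-] /RT[h' <-] lt.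
  (* Condition (iii) for distant columns follows by chaining adjacent ones. *)
  elim: c' lt h' => // d IH; rewrite ltnS leq_eqVlt => /orP[/eqP <-|lt] h'.
    by apply: Pd; lia.
  by apply: leq_trans (IH lt _); [apply: Pd|]; lia.
- move=> i j c ri rj ij /RT[hi <-] /RT[hj <-] lt.
  have [h h'] := Px _ _ _ ij hi hj lt.
  by exists (P i c.+1) => //; apply/RT; split=> //; lia.
Qed.

(** * Columns containing all small entries *)

(* The rows below [v] of such a column are filled by the entries below [v]. *)
Lemma full_column_row a P v c : Kohnert_rows a P -> 1 <= c ->
  (forall u, 1 <= u <= v -> c <= part a u) -> 1 <= v -> P v c = v.
Proof.
case=> Pb Pi _ _ c1; have [n] := ubnP v; elim: n v => // n IH v lt_vn full v1.
have h : 1 <= c <= part a v by rewrite c1 full ?v1 /=.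
have /andP[P1 Pv] := Pb _ _ h.
apply/eqP; rewrite eqn_leq Pv leqNgt; apply/negP => lt.
(* If [v] sat below row [v], the entry numbered [P v c] would by induction already occupy that
   row. *)
have h' : 1 <= c <= part a (P v c) by rewrite c1 full // P1 Pv.
have : P v c = v by apply: (Pi _ _ c) => //; apply: IH => // [|u ?]; [lia|apply: full; lia].
lia.
Qed.

(** The entries up to [n] already fill the rows up to [n], so no cell is left there for a larger
    one. *)
Lemma full_column_above a P n v c : Kohnert_rows a P -> 1 <= c <= part a v ->
  (forall u, 1 <= u <= n -> c <= part a u) -> n < v -> n < P v c.
Proof.
move=> KP h full lt; case: (KP) => Pb Pi _ _.
rewrite ltnNge; apply/negP => le; have /andP[P1 Pv] := Pb _ _ h.
have h' : 1 <= c <= part a (P v c) by have := full (P v c); lia.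
suff : P v c = v by lia.
apply: (Pi _ _ c) => //; apply: full_column_row KP _ _ P1; first by lia.
by move=> u ?; apply: full; lia.
Qed.

(** * Ascents and inversions *)

Lemma part_decreasing a n : (forall j, 1 <= j < n -> part a j.+1 <= part a j) ->
  forall u v, 1 <= u -> u <= v <= n -> part a v <= part a u.
Proof.
move=> dec u v u1; elim: v => [|v IH]; first by lia.
case/andP; rewrite leq_eqVlt => /orP[/eqP->//|le] vn.
by apply: leq_trans (dec v _) (IH _); lia.
Qed.

Lemma no_ascent_decreasing a n : (forall j, 1 <= j < n -> ~ ascent a j) ->
  forall u v, 1 <= u -> u <= v <= n -> part a v <= part a u.
Proof.
move=> nasc; apply: part_decreasing => j jn.
have [lt|le] := ltnP j (size a); last by rewrite part_default.
by rewrite leqNgt; apply/negP => h; apply: (nasc j jn); split=> //; lia.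
Qed.

Lemma first_ascent_exists a :
  (exists i j, inversion a i j) -> exists i, first_ascent a i.
Proof.
move=> [i [j [i1 ij js lt]]].
pose asc k := [&& 1 <= k, k < size a & part a k < part a k.+1].
have ascP k : reflect (ascent a k) (asc k) by apply: and3P.
have [|k /ascP ak kmin] := @ex_minnP asc; last first.
  by exists k; split=> // l /ascP /kmin.
apply: contrapT => nex; suff : part a j <= part a i by rewrite leqNgt lt.
by apply: (@no_ascent_decreasing a j) => [l _ /ascP al||]; [apply: nex; exists l|lia|lia].
Qed.

(** * Compositions without inversions *)

Lemma represents_basic a : represents a (fun v _ => v) (basic_tableau a).
Proof.
move=> r c v; rewrite basic_tableauE; split.
  by case: ifP => // /andP[_ h] [<-].
case=> h <-; rewrite h andbT; case: v h => //=; lia.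
Qed.

Lemma basic_rows a : Kohnert_rows a (fun v _ => v).
Proof. by split=> //= [[|v] c|u v c]; rewrite /=; lia. Qed.

(** The parts weakly decrease, so a column reached by [v] is reached by all smaller entries, which
    forces [v] into row [v]. Conversely, each nonempty row [r] of the basic tableau contains [r],
    the first alternative of (v). *)
Lemma QKT_no_inversion a : (~ exists i j, inversion a i j) ->
  QKT a = [set basic_tableau a].
Proof.
move=> ninv.
have dec u v : 1 <= u -> u <= v -> part a v <= part a u.
  move=> u1; rewrite leq_eqVlt => /orP[/eqP->//|uv].
  have [vs|/part_default->//] := leqP v (size a).
  by rewrite leqNgt; apply/negP => lt; apply: ninv; exists u, v.
apply/seteqP; split=> T /=.
  case=> /Kohnert_tableauP[P RT KP] _.
  apply: represents_inj (represents_basic a).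
  apply: eq_represents RT => v c h; apply: (full_column_row KP); first by lia.
    by move=> u uv; apply: leq_trans (dec u v _ _); lia.
  by case: v h => //=; lia.
move=> ->; have RB := represents_basic a; split.
  by apply/Kohnert_tableauP; exists (fun v _ => v) => //; apply: basic_rows.
move=> r [c]; rewrite -fndSome; case E: (basic_tableau a).[? _]%fmap => [v|//] _; left; exists c.
by have /RB[_ /= vr] := E; rewrite E vr.
Qed.

(** * Renaming entries and exchanging rows, on row functions *)

Lemma Kohnert_rows_decreasing a P v c d : Kohnert_rows a P ->
  1 <= c -> c <= d <= part a v -> P v d <= P v c.
Proof.
case=> _ _ Pd _ c1; elim: d => [|d IH]; first by lia.
case/andP; rewrite leq_eqVlt => /orP[/eqP->//|cd] dv.
by apply: leq_trans (Pd v d _) (IH _); lia.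
Qed.

(** Exchanging the lengths of [i] and [i.+1] does not affect the columns up to [m], since both
    entries reach column [m]. *)
Lemma represents_swap_entries a b i m P T :
  (forall v, part b v = part a (transp i v)) ->
  m <= part a i -> m <= part a i.+1 -> represents a P T ->
  represents b (fun v c => P (if m < c then transp i v else v) c)
    (swap_entries i m.+1 T).
Proof.
move=> ab mi mi1 RT r c v; rewrite swap_entriesE ab.
have -> : omap (fun v => if m < c then transp i v else v) T.[? (r, c)]%fmap
      = Some v <->
    T.[? (r, c)]%fmap = Some (if m < c then transp i v else v).
  case: T.[? _]%fmap => [u|] //=.
  by case: (m < c); split=> -[]; [move<-|move->|move<-|move->]; rewrite ?transpK.
rewrite RT; case: (ltnP m c) => // cm.
by have [[-> ->]|[[-> ->]|[_ [_ ->]]]] := transp_spec i v; split=> -[h e]; split=> //; lia.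
Qed.

Lemma represents_swap_rows a i m k P T : represents a P T ->
  represents a (fun v c => if m <= c <= k then transp i (P v c) else P v c)
    (swap_rows i m k T).
Proof.
move=> RT r c v; rewrite swap_rowsE /move_cell /=.
case: (m <= c <= k); rewrite RT //.
by split=> -[h e]; split=> //; [rewrite e|rewrite -e]; rewrite transpK.
Qed.

(* Here [w] is the longer of the entries [i] and [i.+1]: beyond column [m] it
   is the only one of the two, so that renaming it keeps relative orders. *)
Lemma Kohnert_rows_swap_entries a b i m w P : 1 <= i ->
  (forall v, part b v = part a (transp i v)) ->
  (forall u, 1 <= u <= i.+1 -> m <= part a u) ->
  w = i \/ w = i.+1 -> part a (transp i w) = m ->
  (forall c, m < c <= part a w -> P w c <= i) ->
  Kohnert_rows a P ->
  Kohnert_rows b (fun v c => P (if m < c then transp i v else v) c).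
Proof.
move=> i1 ab full wi short low KP; have [Pb Pi Pd Px] := KP.
have row v c : 1 <= c <= m -> 1 <= v <= i.+1 -> P v c = v.
  move=> cm vi; apply: (full_column_row KP); try lia.
  by move=> u uv; have := full u; lia.
have above v c : 1 <= c <= m -> c <= part a v -> i.+1 < v -> i.+1 < P v c.
  move=> cm cv iv; apply: (full_column_above KP) => //; first by lia.
  by move=> u uv; have := full u; lia.
have fi := full i; have fi1 := full i.+1.
have valid v c : 1 <= c <= part b v ->
    1 <= c <= part a (if m < c then transp i v else v).
  rewrite ab; case: (ltnP m c) => // cm.
  by have [[-> ->]|[[-> ->]|[_ [_ ->]]]] := transp_spec i v; lia.
have sw : (w = i /\ part a i.+1 = m) \/ (w = i.+1 /\ part a i = m).
  by case: wi short => ->; rewrite ?transp_l ?transp_r; [left|right].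
split.
- move=> v c /valid h; have := Pb _ _ h; move: h.
  case: (ltnP m c) => // cm h; have := low c.
  move: h; have [[-> ->]|[[-> ->]|[_ [_ ->]]]] := transp_spec i v;
    by case: sw => -[e1 e2]; rewrite ?e1; lia.
- move=> u v c /valid hu /valid hv /(Pi _ _ _ hu hv).
  by case: ifP => // _; apply: (inv_inj (transpK i)).
- move=> v c h.
  have /valid h1 : 1 <= c <= part b v by lia.
  have /valid h2 : 1 <= c.+1 <= part b v by lia.
  have [cm|cm|cm] := ltngtP c m.
  + have e1 : (m < c) = false by lia.
    have e2 : (m < c.+1) = false by lia.
    by rewrite e1 e2 in h1 h2 *; apply: Pd; lia.
  + have e2 : (m < c.+1) by lia.
    by rewrite cm e2 in h1 h2 *; apply: Pd; lia.
  (* Across this boundary a renamed entry joins one old entry in column [m] to the other in column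
     [m.+1]. The former lies in row [i] or [i.+1], the latter by [low] in a row at most [i]. *)
  subst c; rewrite ltnn ltnSn in h1 h2 *.
  have := Pb _ _ h2; move: h1 h2; have := low m.+1.
  have := row v m; have := Pd v m.
  have [[-> ->]|[[-> ->]|[_ [_ ->]]]] := transp_spec i v;
    by case: sw => -[e1 e2]; rewrite ?e1; lia.
move=> u v c uv hu hv.
have := valid _ _ hv; have := valid _ _ hu.
have [cm|cm] := ltnP m c; last first.
  move=> hu' hv' lt.
  have Ev := row v c; have Eu := row u c; have Av := above v c.
  have Bu := Pb _ _ hu'.
  (* In a full column the entries up to [i.+1] are in order below all others, so only larger
     entries, which keep their names, can cross. *)
  have iv : i.+1 < v by lia.
  have iu : i.+1 < u by lia.
  have [] := Px _ _ _ uv hu' hv' lt; rewrite ab transp_out; try lia.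
  by rewrite if_same.
move=> hu' hv' lt; rewrite (leqW cm) ab.
apply: Px => //.
have := transp_spec i u; have := transp_spec i v.
case=> [[ev ev']|[[ev ev']|[ev [ew ev']]]];
  case=> [[eu eu']|[[eu eu']|[eu [et eu']]]];
  rewrite ev' eu' in hu' hv' *; try lia;
  by case: sw => -[e1 e2]; subst; lia.
Qed.

(* [x] is the row of the entry [i.+1] in the columns [m.+1, ..., k]; no other
   entry of these columns lies in row [x], so that moving the row
   [transp i x] to [x] is monotone on the other entries. *)
Lemma Kohnert_rows_swap_rows a i m k x P : 1 <= i ->
  (forall u, 1 <= u <= i.+1 -> m <= part a u) ->
  part a i = m -> m < k <= part a i.+1 ->
  (forall v c, v < i -> 1 <= c <= part a v -> P v c = v) ->
  x = i \/ x = i.+1 ->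
  (forall c, m < c <= k -> P i.+1 c = x) ->
  (forall v, k <= part a v -> P v k <> transp i x) ->
  (k < part a i.+1 -> P i.+1 k.+1 <= i) ->
  Kohnert_rows a P ->
  Kohnert_rows a (fun v c => if m < c <= k then transp i (P v c) else P v c).
Proof.
move=> i1 full short mk fixed xi Px1 notx tail KP; have [Pb Pi Pd Px] := KP.
have row v c : 1 <= c <= m -> 1 <= v <= i.+1 -> P v c = v.
  move=> cm vi; apply: (full_column_row KP); try lia.
  by move=> u uv; have := full u; lia.
have above v c : 1 <= c <= m -> c <= part a v -> i.+1 < v -> i.+1 < P v c.
  move=> cm cv iv; apply: (full_column_above KP) => //; first by lia.
  by move=> u uv; have := full u; lia.
have px v c : m < c <= k -> c <= part a v -> v <> i.+1 -> P v c <> x.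
  move=> ck cv vi; rewrite -(Px1 c ck) => e; apply: vi.
  by apply: (Pi _ _ c) e; lia.
have tx := transp_spec i x.
split.
(* An entry raised from row [i] is at least [i] by (ii), and it is not [i], which ends at column
   [m]. *)
- move=> v c h; have := Pb _ _ h; case: ifP => // ck.
  have := fixed v c; have := Px1 c ck; have := transp_spec i (P v c).
  have := px v c ck.
  have [->|/eqP vi] := eqVneq v i.+1; first by lia.
  by have [?|/eqP vi'] := eqVneq v i; [subst v|]; lia.
- move=> u v c hu hv; case: ifP => _; last exact: Pi.
  by move/(inv_inj (transpK i)); apply: Pi.
- move=> v c h; have Pvc := Pd v c h.
  have [vi|/eqP vi] := eqVneq v i.+1.
    subst v; case: ifP => ck1; case: ifP => ck //.
    + by rewrite !Px1.
    + by rewrite Px1 //; have := row i.+1 c; lia.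
    + by rewrite (Px1 c ck); (have ek : c = k by lia); subst c; lia.
  have := px v c; have := px v c.+1.
  case: (m < c.+1 <= k) / idP => ck1; case: (m < c <= k) / idP => ck // E1 E.
  + by have := transp_spec i (P v c); have := transp_spec i (P v c.+1); lia.
  + have := row v c; have := above v c; have := fixed v c; have := fixed v c.+1.
    have := transp_spec i (P v c.+1).
    by have [?|/eqP vi'] := eqVneq v i; [subst v|]; lia.
  (* At the right end, [v] lies neither in row [x] nor in row [transp i x], so it is not moved. *)
  + have ek : c = k by lia.
    by subst c; have := notx v; have := transp_spec i (P v k); lia.
move=> u v c uv hu hv.
have Puv := Px u v c uv hu hv.
have [mc|cm] := ltnP m c; last first.
  move=> /= lt; have [cu lt'] := Puv lt; split=> //.
  (* In a full column a crossing lies above row [i.+1], so its witness is not moved even when [c] is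
     [m]. *)
  case: ifP => // ck; have := transp_spec i (P u c.+1).
  have := row u c; have := row v c; have := above v c; have := Pb u c; lia.
have [ck|kc] := leqP c k; last first.
  by have -> : (m < c.+1 <= k) = false by lia.
rewrite (leqW mc) /= => lt.
have ui : u <> i by move=> ?; subst u; lia.
have vi : v <> i by move=> ?; subst v; lia.
have Tv := transp_spec i (P v c); have Tu := transp_spec i (P u c).
have Fu := fixed u c; have Fv := fixed v c.
(* If [v] were [i.+1], then [u < i] would be in its own row, below the row [i] or [i.+1] of [v]. *)
have vi1 : v <> i.+1.
  by move=> ?; subst v; have := Px1 c; lia.
have ckm : m < c <= k by rewrite mc.
have pv : P v c <> x by apply: px => //; lia.
have [?|/eqP ui1] := eqVneq u i.+1.
  subst u; rewrite (Px1 c ckm) in lt Puv Tu; clear Fu.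
  case: (ltnP c k) => ck'.
    by rewrite Px1; [split=> //|]; lia.
  (* In column [k] the row of [v] is neither [i] nor [i.+1], and column [k.+1] is untouched, so the
     old crossing gives the witness. *)
  have ek : c = k by lia.
  have nv : P v c <> transp i x by rewrite ek; apply: notx; lia.
  have tv : transp i (P v c) = P v c by clear - pv nv Tv xi tx; lia.
  rewrite tv in lt *; apply: Puv.
  by clear - pv nv xi tx lt; lia.
have pu : P u c <> x by apply: px => //; lia.
have [] := Puv; first by clear - pv pu Tv Tu lt xi; lia.
move=> cu lt'; split=> //; case: ifP => ck1.
  have pu1 : P u c.+1 <> x by apply: px => //; lia.
  by have := transp_spec i (P u c.+1); clear - pv pu1 Tv lt' xi; lia.
have ek : c = k by lia.
have := notx v; have := notx u; rewrite -ek.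
by clear - pv pu Tv Tu lt lt' xi tx hu hv; lia.
Qed.

(** Condition (v) on row [r] looks only at rows [r] and [r.+1], so it transfers above row [n]; up to
    row [n], column 1 provides its first alternative. *)
Lemma quasi_Yamanouchi_above n (T T' : filling) : on_positive_cells T' ->
  (forall r, 1 <= r <= n -> T'.[? (r, 1)]%fmap = Some r) ->
  (forall r c, n < r -> T.[? (r, c)]%fmap = T'.[? (r, c)]%fmap) ->
  quasi_Yamanouchi T -> quasi_Yamanouchi T'.
Proof.
move=> pos basic eqT QT r [c rc].
have [v E] : exists v, T'.[? (r, c)]%fmap = Some v.
  by rewrite -fndSome in rc; case: T'.[? _]%fmap rc => // v; exists v.
have [r1 _ _] := pos _ _ _ E.
have [rn|nr] := leqP r n; first by left; exists 1; apply: basic; rewrite r1.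
case: (QT r) => [|[d Ed]|[d [d' [h1 h2 h3]]]].
- by exists c; rewrite -fndSome eqT // E.
- by left; exists d; rewrite -eqT.
right; exists d, d'; rewrite -!fndSome in h1 h2 *.
by rewrite -!eqT ?(leqW nr).
Qed.

(** * Tableaux at the first ascent *)

Section FirstAscent.

Context (a : weak_composition) (i : nat).
Hypothesis a_strong : strong a.
Hypothesis asc_i : first_ascent a i.

Let b := swap_parts a i.
Let m := part a i.

(** Strongness gives [1 <= m], so column 1 is among the full columns, as the quasi-Yamanouchi
    condition will require. *)
Lemma first_ascent_facts : [/\ 1 <= i, i < size a, m < part a i.+1, 1 <= m
  & forall u v, 1 <= u -> u <= v <= i -> part a v <= part a u].
Proof.
case: (asc_i) => -[i1 iz lt] imin; split=> //.
  case: i i1 iz @m {lt imin} => // j _ jz /=.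
  by move/all_nthP: a_strong; apply; apply: ltnW.
by apply: no_ascent_decreasing => j ji /imin; lia.
Qed.

Lemma part_swapped v : part b v = part a (transp i v).
Proof. by have [i1 iz _ _ _] := first_ascent_facts; apply: part_swap. Qed.

Lemma part_unswap v : part a v = part b (transp i v).
Proof. by rewrite part_swapped transpK. Qed.

Lemma columns_full u : 1 <= u <= i.+1 -> m <= part a u.
Proof.
have [i1 iz lt m1 dec] := first_ascent_facts => ui.
have [->|ui1] := eqVneq u i.+1; first exact: ltnW.
by apply: dec; lia.
Qed.

Lemma columns_full_swapped u : 1 <= u <= i.+1 -> m <= part b u.
Proof.
have [i1 iz lt m1 dec] := first_ascent_facts => ui.
by rewrite part_swapped; apply: columns_full; have := transp_spec i u; lia.
Qed.

(** The parts up to [i] decrease, so even beyond column [m] all entries below [v] accompany it. *)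
Lemma fixed_row P v c : Kohnert_rows a P -> v <= i -> 1 <= c <= part a v ->
  P v c = v.
Proof.
have [i1 iz lt m1 dec] := first_ascent_facts => KP vi h.
apply: (full_column_row KP); first by lia.
  by move=> u uv; have := dec u v; lia.
by case: v h {vi} => //=; lia.
Qed.

(** Stated for any [e] with full columns up to [m], to serve both the composition and its swap. *)
Lemma QKT_above e Q (T T' : filling) : (forall u, 1 <= u <= i.+1 -> m <= part e u) ->
  Kohnert_rows e Q -> represents e Q T' ->
  (forall r c, i.+1 < r -> T.[? (r, c)]%fmap = T'.[? (r, c)]%fmap) ->
  quasi_Yamanouchi T -> QKT e T'.
Proof.
have [i1 iz lt m1 dec] := first_ascent_facts => full KQ RQ eqT QT.
have KT : Kohnert_tableau e T' by apply/Kohnert_tableauP; exists Q.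
split=> //; have [pos _ _ _] := KT.
apply: (quasi_Yamanouchi_above pos _ eqT QT) => r ri.
apply/RQ; have f := full r ri; split; first by lia.
apply: (full_column_row KQ) => //; last by lia.
by move=> u ur; have := full u; lia.
Qed.

(** By (ii), an entry above row [i.+1] exceeds [i.+1] and is not renamed. *)
Lemma swap_entries_above e P T r c : Kohnert_rows e P -> represents e P T ->
  i.+1 < r -> T.[? (r, c)]%fmap = (swap_entries i m.+1 T).[? (r, c)]%fmap.
Proof.
move=> [Pb _ _ _] RT ir; rewrite swap_entriesE.
case E: T.[? _]%fmap => [v|//] /=; congr Some.
have [h er] := (RT _ _ _).1 E; have := Pb _ _ h; have := transp_spec i v.
by case: (m < c); lia.
Qed.

Lemma swap_rows_above k (T : filling) r c : i.+1 < r ->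
  T.[? (r, c)]%fmap = (swap_rows i m.+1 k T).[? (r, c)]%fmap.
Proof.
move=> ir; rewrite swap_rowsE /move_cell /= transp_out; try lia.
by rewrite if_same.
Qed.

(** * The two inclusions *)

Lemma S_set_sub_QKT That : QKT b That -> S_set a i That `<=` QKT a.
Proof.
have [i1 iz lt m1 dec] := first_ascent_facts.
move=> [/Kohnert_tableauP[P RP KP] QY].
have m_b : part b i.+1 = m by rewrite part_swapped transp_r.
have M_b : part b i = part a i.+1 by rewrite part_swapped transp_l.
have low c : 1 <= c <= part b i -> P i c <= i.
  by case: KP => Pb _ _ _ /Pb; lia.
pose P0 v c := P (if m < c then transp i v else v) c.
have KP0 : Kohnert_rows a P0.
  apply: (Kohnert_rows_swap_entries (w := i)) KP => //.
  - exact: part_unswap.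
  - exact: columns_full_swapped.
  - by left.
  - by rewrite transp_l m_b.
  by move=> c mc; apply: low; lia.
have R0 : represents a P0 (swap_entries i m.+1 That).
  by apply: represents_swap_entries RP; [exact: part_unswap|lia|lia].
have Q0 : QKT a (swap_entries i m.+1 That).
  apply: (QKT_above columns_full KP0 R0 _ QY) => r c ir.
  exact: swap_entries_above KP RP ir.
move=> T [->//|[k [mk E1 E2 ->]]].
have [_ QY0] := Q0.
have [hk Pk] := (R0 _ _ _).1 E2.
apply: QKT_above columns_full _ (represents_swap_rows i m.+1 k R0) _ QY0; last first.
  by move=> r c; apply: swap_rows_above.
have low0 c : m < c <= part a i.+1 -> P0 i.+1 c <= i.
  by move=> mc; rewrite /P0 ifT ?transp_r; [apply: low|]; lia.
apply: (Kohnert_rows_swap_rows (x := i)) => //.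
- exact: columns_full.
- by move=> v c vi; apply: fixed_row => //; apply: ltnW.
- by left.
(* Row [i] is a lower bound by descent to column [k], and an upper bound by [low0]. *)
- move=> c mc; have := low0 c.
  by have := @Kohnert_rows_decreasing _ _ i.+1 c k KP0; lia.
- move=> v kv; rewrite transp_l => e.
  have /R0 : 1 <= k <= part a v /\ P0 v k = i.+1 by split=> //; lia.
  by rewrite E1.
- by move=> ?; apply: low0; lia.
Qed.

(** The stretch to undo ends at the last column [k > m] where [i.+1] lies in row [i.+1]; if there is
    none, the tableau is its own [T0]. *)
Lemma QKT_sub_S_set : QKT a `<=` \bigcup_(That in QKT b) S_set a i That.
Proof.
have [i1 iz lt m1 dec] := first_ascent_facts.
move=> T QT; have [/Kohnert_tableauP[P RP KP] QY] := QT.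
(* [T0] is [T] with its entries [i.+1] pushed out of row [i.+1] beyond
   column [m]. *)
suff [T0 [P0 [R0 K0 [Q0 low ST]]]] : exists T0 P0,
    [/\ represents a P0 T0, Kohnert_rows a P0 &
     [/\ QKT a T0, forall c, m < c <= part a i.+1 -> P0 i.+1 c <= i &
       T = T0 \/ exists k, [/\ m.+1 <= k <= part a i.+1,
         T0.[? (i.+1, k)]%fmap = None, T0.[? (i, k)]%fmap = Some i.+1 &
         T = swap_rows i m.+1 k T0]]].
  exists (swap_entries i m.+1 T0); last first.
    by rewrite /S_set; cbv zeta; rewrite swap_entriesK.
  have Rhat : represents b (fun v c => P0 (if m < c then transp i v else v) c)
      (swap_entries i m.+1 T0).
    by apply: represents_swap_entries R0; [exact: part_swapped|lia|lia].
  have [_ QY0] := Q0.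
  apply: (QKT_above columns_full_swapped _ Rhat _ QY0); last first.
    by move=> r c; apply: swap_entries_above K0 R0.
  apply: (Kohnert_rows_swap_entries (w := i.+1)) K0 => //.
  - exact: part_swapped.
  - exact: columns_full.
  - by right.
  by rewrite transp_r.
have [Pb Pi Pd Px] := KP.
pose stays c := (m < c <= part a i.+1) && (P i.+1 c == i.+1).
have low c : m < c <= part a i.+1 -> ~~ stays c -> P i.+1 c <= i.
  by move=> mc; rewrite /stays mc /= => /eqP; have := Pb i.+1 c; lia.
have [/hasP[c0 _ sc0]|/hasPn none] := boolP (has stays (iota 0 (part a i.+1).+1)); last first.
  exists T, P; split=> //; split=> //; last by left.
  by move=> c mc; apply: low => //; apply: none; rewrite mem_iota; lia.
have [||k /andP[mk /eqP Pk] kmax] := @ex_maxnP stays (part a i.+1).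
- by exists c0.
- by move=> c; rewrite /stays; lia.
have tail c : k < c <= part a i.+1 -> P i.+1 c <= i.
  move=> kc; apply: low; first by lia.
  by apply/negP => /kmax; lia.
have Px1 c : m < c <= k -> P i.+1 c = i.+1.
  move=> mc; have := Pb i.+1 c; have := @Kohnert_rows_decreasing _ _ i.+1 c k KP; lia.
(* An entry up to [i] in row [i] would be [i], which ends at column [m < k]. An entry beyond [i.+1]
   there would cross [i.+1], and (iv) would put [i.+1] above row [i] in column [k.+1], against the
   maximality of [k]. *)
have noti v : k <= part a v -> P v k <> i.
  move=> kv e; have := Pb v k.
  have [vi|iv] := leqP v i.
    by have ev := @fixed_row P v k KP vi; have ? : v = i; [|subst v]; lia.
  have [?|/eqP vi1] := eqVneq v i.+1; first by subst v; lia.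
  by have := Px i.+1 v k; have := tail k.+1; lia.
have R0 := represents_swap_rows i m.+1 k RP.
set P0 := (X in represents a X _) in R0.
have K0 : Kohnert_rows a P0.
  apply: (Kohnert_rows_swap_rows (x := i.+1)) KP => //.
  + exact: columns_full.
  + by move=> v c vi; apply: fixed_row => //; apply: ltnW.
  + by right.
  + by rewrite transp_r.
  + by move=> ?; apply: tail; lia.
exists (swap_rows i m.+1 k T), P0; split=> //; split.
- apply: (QKT_above columns_full K0 R0 _ QY) => r c; apply: swap_rows_above.
- move=> c mc; rewrite /P0; case: ifP => ck.
    by rewrite Px1 // transp_r.
  by apply: tail; lia.
right; exists k; split=> //.
(* An entry in this cell would come from row [i] of column [k] of [T], which is empty by [noti]. *)
- case E: fnd => [v|//]; have [hv] := (R0 _ _ _).1 E.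
  rewrite /P0 ifT; last by lia.
  by have := noti v; have := transp_spec i (P v k); lia.
- apply/R0; split; first by lia.
  by rewrite /P0 ifT ?Pk ?transp_r; lia.
by rewrite swap_rowsK.
Qed.

End FirstAscent.

Theorem theorem4p4 (alpha : weak_composition) (alpha_strong : strong alpha) :
  ((~ exists i j, inversion alpha i j) ->
     QKT alpha = [set basic_tableau alpha]) /\
  ((exists i j, inversion alpha i j) ->
     exists2 i, first_ascent alpha i &
       QKT alpha =
         \bigcup_(That in QKT (swap_parts alpha i)) S_set alpha i That).
Proof.
split; first exact: QKT_no_inversion.
case/first_ascent_exists=> i asc_i; exists i => //.
apply/seteqP; split; first exact: QKT_sub_S_set.
by apply: bigcup_sub => That; apply: S_set_sub_QKT.
Qed.
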